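(* Suppose $s \in \mathcal{L}^+(\mathcal{S})$. Let the function $f:[0,\infty) \to [0,\infty)$ be continuous and increasing and define the function $\tilde f(t):=\int_0^t f(u)\,du$, $t\ge 0$. Then the following statements hold for any $M>0$. (i) If $\liminf_{t\downarrow 0} (C'_{t+\tau_s}-s)/f(t)>M$ a.s., then $\liminf_{t \downarrow 0} (X_{t+\tau_s}-m_s-st)/\tilde f(t)\ge M$ a.s. (ii) If $\limsup_{t\downarrow 0} (C'_{t+\tau_s}-s)/f(t)<M$ a.s., then $\liminf_{t \downarrow 0} (X_{t+\tau_s}-m_s-st)/\tilde f(t)\le M$ a.s.
   Context: $X=(X_t)_{t\ge0}$ is a real-valued Lévy process (with càdlàg paths) that is not a compound Poisson process with drift. Fix a deterministic $T>0$. $C=(C_t)_{t\in[0,T]}$ is the convex minorant of $X$ on $[0,T]$, i.e. the pointwise largest convex function with $C_t\le X_t$ for all $t\in[0,T]$; it is a.s. piecewise linear (with countably many maximal open intervals of linearity). $C'=(C'_t)_{t\in(0,T)}$ is its right-derivative. For $s\in\mathbb{R}$ the vertex time is $\tau_s:=\inf\{t\in(0,T):C'_t>s\}\wedge T$ (with $\inf\emptyset=\infty$). $\mathcal{S}$ is the random countable set of slopes of $C$ (the image of $C'$ over the open intervals of linearity of $C$). The set of its right-limit points $\mathcal{L}^+(\mathcal{S}):=\{x\in\mathbb{R}:\mathcal{S}\cap(x,x+\varepsilon)\neq\emptyset\text{ for all }\varepsilon>0\}$ is known to be a.s. deterministic and independent of $T$; equivalently, $s\in\mathcal{L}^+(\mathcal{S})$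 if and only if $\int_0^1\mathbb{P}(X_t/t\in(s,s+\varepsilon))\,t^{-1}dt=\infty$ for all $\varepsilon>0$. Write $X_{t-}:=\lim_{u\uparrow t}X_u$ for $t>0$, $X_{0-}:=X_0$, and $m_s:=\min\{X_{\tau_s},X_{\tau_s-}\}$. ''Increasing'' means strictly increasing. *)

(* Defs.v *)
From mathcomp Require Import all_boot all_order all_algebra.
From mathcomp Require Import all_classical all_reals all_analysis.
Set Implicit Arguments.
Unset Strict Implicit.
Unset Printing Implicit Defensive.
Import Order.TTheory GRing.Theory Num.Theory.
Import numFieldNormedType.Exports.
Local Open Scope classical_set_scope.
Local Open Scope ring_scope.

(** Deterministic path functionals.  A path is a function [x : R -> R] of which
    only the values at nonnegative times (or at times in [0, T]) matter. *)
Section paths.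
Context {R : realType}.
Implicit Types (x c : R -> R) (T s t : R) (S : set R).

Definition cadlag x :=
  (forall t, 0 <= t -> x u @[u --> t^'+] --> x t) /\
  (forall t, 0 < t -> cvg (x u @[u --> t^'-])).

(* x(t-), with the convention x(0-) = x(0). *)
Definition left_limit x t : R :=
  if 0 < t then lim (x u @[u --> t^'-]) else x 0.

Definition minorizing_convex T x : set (R -> R) :=
  [set g | convex_function (`[0, T] : set R) g /\
           forall u, 0 <= u <= T -> g u <= x u].

(* A pointwise supremum of convex functions is convex, so for a path bounded
   below on [0, T] (e.g. a cadlag one) this is the largest element of
   [minorizing_convex T x]; see [convex_minorantP].  The values outside [0, T]
   are irrelevant. *)
Definition convex_minorant T x : R -> R :=
  fun t => sup [set g t | g in minorizing_convex T x].

Definition right_deriv c t : R := lim (h^-1 * (c (t + h) - c t) @[h --> 0^'+]).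

(* inf {t in (0, T) : c'(t) > s} /\ T; the infimum is taken in the extended
   reals, where it is +oo on the empty set. *)
Definition vertex_time T c s : R :=
  fine (Order.min
    (ereal_inf [set t%:E | t in [set t | 0 < t < T /\ s < right_deriv c t]])
    T%:E).

(* ]a, b[ is a nonempty open subinterval of [0, T] on which c is affine. *)
Definition interval_of_linearity T c (a b : R) :=
  [/\ 0 <= a, a < b, b <= T &
      exists p q : R, forall t, a < t < b -> c t = p + q * t].

Definition slopes T c : set R :=
  [set r | exists a b, interval_of_linearity T c a b /\
           exists2 t, a < t < b & right_deriv c t = r].

Definition right_limit_points S : set R :=
  [set r | forall e : R, 0 < e -> S `&` [set y | r < y < r + e] !=set0].

Lemma convex_minorantP T x : (exists m, forall u, 0 <= u <= T -> m <= x u) ->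
  [/\ convex_function (`[0, T] : set R) (convex_minorant T x),
      forall u, 0 <= u <= T -> convex_minorant T x u <= x u &
      forall g, convex_function (`[0, T] : set R) g ->
        (forall u, 0 <= u <= T -> g u <= x u) ->
        forall u, 0 <= u <= T -> g u <= convex_minorant T x u].
Proof.
move=> [m hm].
have cstm : minorizing_convex T x (cst m).
  by split=> // t u v _ _; rewrite /cst convRE -mulrDl addrC subrK mul1r.
have ub t : 0 <= t <= T -> ubound [set g t | g in minorizing_convex T x] (x t).
  by move=> tT _ [g [_ gx] <-]; exact: gx.
have has t : 0 <= t <= T -> has_sup [set g t | g in minorizing_convex T x].
  by move=> tT; split; [exists m, (cst m) | exists (x t); exact: ub].
have le_sup g t : minorizing_convex T x g -> 0 <= t <= T ->
    g t <= convex_minorant T x t.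
  by move=> hg /has hs; apply: ub_le_sup; [exact: hs.2 | exists g].
split=> [t u v uT vT|u uT|g cg gx u uT]; last exact: le_sup.
  have inT (y : R) : y \in `[0, T]%classic -> 0 <= y <= T.
    by rewrite inE /= in_itv.
  have := uT => /inT u0T; have := vT => /inT v0T.
  apply: ge_sup; first by exists m, (cst m).
  move=> _ [g hg <-]; apply: (le_trans (hg.1 t u v uT vT)).
  rewrite !convRE; apply: lerD; apply: ler_wpM2l; try exact: le_sup.
    exact: ge0.
  by rewrite subr_ge0 le1.
by apply: ge_sup; [exists m, (cst m) | exact: ub].
Qed.
End paths.

Section processes.
Context d (Omega : measurableType d) (R : realType) (P : probability Omega R).
Implicit Types (X Y : R -> Omega -> R).

Definition independent_increments X :=
  forall (n : nat) (t : nat -> R) (B : nat -> set R),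
    0 <= t 0%N -> (forall i, t i <= t i.+1) -> (forall i, measurable (B i)) ->
    P (\bigcap_(i in `I_n) [set w | B i (X (t i.+1) w - X (t i) w)]) =
    (\prod_(i < n) fine (P [set w | B i (X (t i.+1) w - X (t i) w)]))%:E.

Definition stationary_increments X :=
  forall (t h : R) (B : set R), 0 <= t -> 0 <= h -> measurable B ->
    P [set w | B (X (t + h) w - X t w)] = P [set w | B (X h w - X 0 w)].

Record levy_process X : Prop := {
  levy_measurable : forall t, 0 <= t -> measurable_fun setT (X t) ;
  levy_start : {ae P, forall w, X 0 w = 0} ;
  levy_independent : independent_increments X ;
  levy_stationary : stationary_increments X ;
  levy_cadlag : {ae P, forall w, cadlag (X ^~ w)} }.

(* lambda = 0 is allowed: then N = 0 almost surely. *)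
Definition poisson_process (lambda : R) (N : R -> Omega -> nat) :=
  levy_process (fun t w => (N t w)%:R) /\
  forall t k, 0 <= t ->
    P [set w | N t w = k] =
    (expR (- (lambda * t)) * (lambda * t) ^+ k / k`!%:R)%:E.

Definition iid (J : nat -> Omega -> R) :=
  [/\ forall k, measurable_fun setT (J k),
      forall k (B : set R), measurable B -> P (J k @^-1` B) = P (J 0%N @^-1` B) &
      forall (n : nat) (B : nat -> set R), (forall k, measurable (B k)) ->
        P (\bigcap_(k in `I_n) (J k @^-1` B k)) =
        (\prod_(k < n) fine (P (J k @^-1` B k)))%:E].

(* Independence of the process N and the sequence J, expressed on the finite
   dimensional cylinders, which form pi-systems generating sigma(N), sigma(J). *)
Definition independent_of_sequence (N : R -> Omega -> nat)
    (J : nat -> Omega -> R) :=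
  forall (m n : nat) (t : nat -> R) (A : nat -> set nat) (B : nat -> set R),
    (forall i, 0 <= t i) -> (forall k, measurable (B k)) ->
    P ((\bigcap_(i in `I_m) (N (t i) @^-1` A i)) `&`
       (\bigcap_(k in `I_n) (J k @^-1` B k))) =
    (P (\bigcap_(i in `I_m) (N (t i) @^-1` A i)) *
     P (\bigcap_(k in `I_n) (J k @^-1` B k)))%E.

(* X_t = gamma t + J_0 + ... + J_(N_t - 1).  The Poisson process and the jumps
   may be sought on the same space, as they can be read off the path of X. *)
Definition compound_poisson_with_drift X :=
  exists (gamma lambda : R) (N : R -> Omega -> nat) (J : nat -> Omega -> R),
    [/\ 0 <= lambda, poisson_process lambda N, iid J,
        independent_of_sequence N J &
        {ae P, forall w, forall t, 0 <= t ->
          X t w = gamma * t + \sum_(k < N t w) J k w}].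

End processes.

(* Main.v *)
Require Import Defs.
From mathcomp Require Import all_boot all_order all_algebra.
From mathcomp Require Import all_classical all_reals all_analysis.
From mathcomp Require Import ring lra.
Set Implicit Arguments.
Unset Strict Implicit.
Unset Printing Implicit Defensive.
Import Order.TTheory GRing.Theory Num.Theory.
Import numFieldNormedType.Exports.
Local Open Scope classical_set_scope.
Local Open Scope ring_scope.

(** The argument is pathwise and uses only that the path [x] is cadlag.  Since [s]
    is a right limit of slopes, the convex minorant [C] is not affine to the
    right of [tau], so [C] meets the lower semicontinuous envelope of [x] at
    [tau], that is [C tau = m].  Integrating the bound on [C' - s] from [tau]
    then compares [C (tau + t) - m - s t] with [M] times the primitive of [f].
    For (i) one concludes by [C <= x].  For (ii), strictly smaller slopes keep
    occurring closer to [tau], so vertices of [C] accumulate at [tau] from the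
    right; at each of them [C] equals [x] or its left limit, so [x] cannot stay
    a positive amount above [C].

    The integration avoids absolute continuity of [C]: a function whose
    increments over [u, v] are at least [- (v - u) (f v - f u)] is nondecreasing
    (see [nondecreasing_of_increments]). *)

(** * Convex functions on [[0, T]]: chords, right derivatives, interior continuity *)

Section convex_functions.
Context {R : realType} (T : R).
Implicit Types c L : R -> R.

Lemma convex_functionP c : convex_function (`[0, T] : set R) c <->
  forall p x y, 0 <= p <= 1 -> 0 <= x <= T -> 0 <= y <= T ->
    c (p * x + (1 - p) * y) <= p * c x + (1 - p) * c y.
Proof.
split=> [cc p x y /andP[p0 p1] xT yT|cc t x y].
  have := cc (Itv01 p0 p1) x y; rewrite !inE /= !in_itv /=.
  by move=> /(_ xT yT).
rewrite !inE /= !in_itv /= => xT yT.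
by rewrite !convRE; apply: cc => //; rewrite ge0 le1.
Qed.

(** Supplies the competitor to the convex minorant in [convex_minorant_chord]. *)
Lemma convex_function_maxr c (q k : R) :
  convex_function (`[0, T] : set R) c ->
  convex_function (`[0, T] : set R) (fun u => Num.max (c u) (q * u + k)).
Proof.
move=> /convex_functionP cc; apply/convex_functionP => p x y p01 xT yT.
have [p0 p1] := andP p01.
have le1 (a b a' b' : R) : a <= a' -> b <= b' ->
    p * a + (1 - p) * b <= p * a' + (1 - p) * b'.
  by move=> aa' bb'; apply: lerD; apply: ler_wpM2l => //; lra.
rewrite ge_max; apply/andP; split.
  by apply: (le_trans (cc _ _ _ p01 xT yT)); apply: le1; rewrite le_max lexx.
rewrite (_ : _ + k = p * (q * x + k) + (1 - p) * (q * y + k)); last by ring.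
by apply: le1; rewrite le_max lexx orbT.
Qed.

Variable c : R -> R.
Hypothesis cc : convex_function (`[0, T] : set R) c.

(** Clearing the denominator [b - a] lets the chord inequality include [a = b] and serve directly in
    linear arithmetic. *)
Lemma convex_function_chord a u b : 0 <= a -> a <= u <= b -> b <= T ->
  (b - a) * c u <= (b - u) * c a + (u - a) * c b.
Proof.
move=> a0 /andP[au ub] bT.
have [ab|ba] := ltP a b; last first.
  have -> : u = a by apply/le_anti; rewrite au (le_trans ub ba).
  have -> : b = a by apply/le_anti; rewrite ba (le_trans au ub).
  by rewrite subrr !mul0r addr0.
have ba0 : 0 < b - a by lra.
have p01 : 0 <= (b - u) / (b - a) <= 1.
  by rewrite divr_ge0 ?ler_pdivrMr//; lra.
have := (convex_functionP c).1 cc _ a b p01.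
rewrite (_ : _ * a + _ = u); last by field; rewrite gt_eqF.
move=> /(_ ltac:(lra) ltac:(lra)); rewrite -(ler_pM2l ba0) => /le_trans; apply.
by rewrite le_eqVlt; apply/orP; left; apply/eqP; field; rewrite gt_eqF.
Qed.

(** The right difference quotients [q h] are monotone in [h] and bounded below by the slopes of
    chords ending at [t]. Hence the [lim] in [right_deriv] exists and separates left slopes from
    right slopes. *)
Lemma convex_function_subgradient t u : 0 < t < T -> 0 <= u <= T ->
  (u - t) * right_deriv c t <= c u - c t.
Proof.
move=> /andP[t0 tT] /andP[u0 uT].
pose q h := h^-1 * (c (t + h) - c t).
have ndq h k : 0 < h -> h <= k -> t + k <= T -> q h <= q k.
  move=> h0 hk tk; rewrite /q.
  have := @convex_function_chord t (t + h) (t + k) ltac:(lra) ltac:(lra) tk.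
  have k0 : 0 < k by lra.
  rewrite ![_^-1 * _]mulrC ler_pdivrMr // mulrAC ler_pdivlMr //; lra.
have ge_q v h : 0 <= v < t -> 0 < h -> t + h <= T ->
    (c t - c v) / (t - v) <= q h.
  move=> /andP[v0 vt] h0 hT; rewrite /q.
  have tv0 : 0 < t - v by lra.
  have := @convex_function_chord v t (t + h) v0 ltac:(lra) hT.
  rewrite [_^-1 * _]mulrC ler_pdivrMr // mulrAC ler_pdivlMr //; lra.
have Tt : 0 < T - t by lra.
have near_T : \forall h \near 0^'+, 0 < h /\ t + h <= T.
  near=> h; split; near: h; first exact: nbhs_right_gt.
  by apply: filterS (nbhs_right_le Tt) => h; lra.
have cvq : cvg (q h @[h --> 0^'+]).
  apply: nondecreasing_at_right_is_cvgr.
    near=> b => h k; rewrite !in_itv /= => /andP[h0 hb] /andP[k0 kb] hk.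
    apply: ndq => //; have : b <= T - t by near: b; exact: nbhs_right_le.
    lra.
  near=> b; exists ((c t - c 0) / (t - 0)) => _ [h /= + <-].
  rewrite in_itv /= => /andP[h0 hb]; apply: ge_q => //; first lra.
  have : b <= T - t by near: b; exact: nbhs_right_le.
  lra.
have [ut|tu|<-] := ltgtP u t; last by rewrite subrr mul0r subrr.
- have tu0 : 0 < t - u by lra.
  have : (c t - c u) / (t - u) <= right_deriv c t.
    apply: limr_ge => //.
    by apply: filterS near_T => h [h0 hT]; apply: ge_q => //; rewrite u0.
  rewrite ler_pdivrMr //; lra.
- have ut0 : 0 < u - t by lra.
  have : right_deriv c t <= q (u - t).
    apply: limr_le => //; near=> h; apply: ndq; last lra.
      by near: h; exact: nbhs_right_gt.
    by near: h; exact: nbhs_right_le.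
  rewrite /q [_^-1 * _]mulrC ler_pdivlMr // (addrC t) subrK; lra.
Unshelve. all: by end_near. Qed.

(** Add the subgradient inequalities at [t] and at [u]. *)
Lemma convex_function_right_deriv_nd t u : 0 < t -> t <= u -> u < T ->
  right_deriv c t <= right_deriv c u.
Proof.
move=> t0; rewrite le_eqVlt => /predU1P[-> //|tu] uT.
have := @convex_function_subgradient t u ltac:(lra) ltac:(lra).
have := @convex_function_subgradient u t ltac:(lra) ltac:(lra).
move=> h1 h2; have ut0 : 0 < u - t by lra.
rewrite -(ler_pM2l ut0); lra.
Qed.

(** By monotonicity the right derivative is bounded by [K] on [[t / 2, (t + T) / 2]]; the
    subgradient inequalities at [t] and [u] then give a Lipschitz bound. *)
Lemma convex_function_near t e : 0 < t < T -> 0 < e ->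
  exists2 r, 0 < r & forall u, 0 <= u <= T -> `|u - t| < r -> `|c u - c t| < e.
Proof.
move=> /andP[t0 tT] e0.
pose lo := right_deriv c (t / 2); pose hi := right_deriv c ((t + T) / 2).
pose K := `|lo| + `|hi| + 1.
have K0 : 0 < K by rewrite /K; have := normr_ge0 lo; have := normr_ge0 hi; lra.
exists (Num.min (Num.min (t / 2) ((T - t) / 2)) (e / K)).
  by rewrite !lt_min divr_gt0 // divr_gt0 ?divr_gt0//; lra.
move=> u uT; rewrite !lt_min.
move=> /andP[/andP[/ltr_normlP[ut1 ut2] /ltr_normlP[ut3 ut4]] utK].
have bnd v : t / 2 <= v <= (t + T) / 2 -> `|right_deriv c v| <= K.
  move=> v1; have := @convex_function_right_deriv_nd (t / 2) v.
  have := @convex_function_right_deriv_nd v ((t + T) / 2).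
  rewrite -/lo -/hi => /(_ ltac:(lra) ltac:(lra) ltac:(lra)) h1.
  move=> /(_ ltac:(lra) ltac:(lra) ltac:(lra)) h2.
  rewrite /K ler_norml.
  move: (ler_norm hi) (ler_norm (- lo)) (normr_ge0 hi) (normr_ge0 lo).
  by rewrite normrN => *; apply/andP; split; lra.
have h1 := @convex_function_subgradient t u ltac:(lra) uT.
have h2 := @convex_function_subgradient u t ltac:(lra) ltac:(lra).
have le_uv v : t / 2 <= v <= (t + T) / 2 -> `|(u - t) * right_deriv c v| < e.
  move=> /bnd bv; rewrite normrM; apply: le_lt_trans (_ : `|u - t| * K < e).
    by rewrite ler_wpM2l.
  by rewrite -ltr_pdivlMr.
have := le_uv t ltac:(lra); have := le_uv u ltac:(lra).
by rewrite !ltr_norml => /andP[? ?] /andP[? ?]; apply/andP; split; lra.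
Qed.

End convex_functions.

(** * The convex minorant of a cadlag path and its contact with the path *)

Section convex_minorant.
Context {R : realType}.
Implicit Types (x : R -> R) (T : R).

Lemma cadlag_bounded_below T x : cadlag x ->
  exists m, forall u, 0 <= u <= T -> m <= x u.
Proof.
move=> [xr xl].
(* Asking for all [m] near [-oo] lets compactness glue the local bounds. The guard [0 <= u] is there
   because neighbourhoods of [0] contain negative times, where [x] is arbitrary. *)
have [m hm] : \forall m \near -oo,
    `[0, T]%classic `<=` (fun u => 0 <= u -> m <= x u).
  have /compact_near_coveringP := @segment_compact R 0 T.
  apply => t /=; rewrite in_itv /= => /andP[t0 tT].
  have [k hk] : exists k, \forall u \near t, 0 <= u -> k <= x u.
    have /cvgr_ge /(_ (x t - 1)) /(_ ltac:(lra)) := xr t t0.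
    rewrite near_withinE => hr.
    have [l hl] : exists l, \forall u \near t, u < t -> 0 <= u -> l <= x u.
      have [t_gt0|t_le0] := ltP 0 t; last first.
        by exists 0; near=> u => ut u0; exfalso; lra.
      have /cvgr_ge /(_ (lim (x u @[u --> t^'-]) - 1)) /(_ ltac:(lra)) := xl t t_gt0.
      rewrite near_withinE => hl; exists (lim (x u @[u --> t^'-]) - 1).
      by apply: filterS hl => u hu ut _; apply: hu.
    exists (Num.min (Num.min l (x t - 1)) (x t)).
    near=> u => u0; rewrite !ge_min.
    have [ut|ut|->] := ltgtP u t; last by rewrite lexx orbT.
    - by rewrite (near hl u).
    - by rewrite (near hr u) ?orbT.
  exists ([set u | 0 <= u -> k <= x u], [set m | m <= k]) => /=.
    by split=> //; apply: nbhs_ninfty_le; rewrite num_real.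
  by move=> [u m] /= [hu mk] u0; apply: le_trans mk (hu u0).
exists (m - 1) => u /[dup] uT /andP[u0 _]; apply: (hm.2 (m - 1)) => //.
by rewrite gtrBl.
Unshelve. all: by end_near. Qed.

(** The subgradient inequalities from [u] towards [a] and [b] squeeze the right derivative onto [q],
    so no limit is computed. *)
Lemma affine_right_deriv T c a b q k : convex_function (`[0, T] : set R) c ->
  0 <= a -> b <= T -> (forall u, a <= u <= b -> c u = q * u + k) ->
  forall u, a < u < b -> right_deriv c u = q.
Proof.
move=> cc a0 bT cE u /andP[au ub].
have := @convex_function_subgradient _ T c cc u a ltac:(lra) ltac:(lra).
have := @convex_function_subgradient _ T c cc u b ltac:(lra) ltac:(lra).
rewrite !cE; [|lra..].
rewrite [q * b + _ - _](_ : _ = (b - u) * q); last by ring.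
rewrite [q * a + _ - _](_ : _ = (a - u) * q); last by ring.
rewrite ler_pM2l ?subr_gt0// ler_nM2l ?subr_lt0// => h1 h2.
by apply/le_anti/andP.
Qed.

Context (T : R) (x : R -> R).
Hypothesis xcadlag : cadlag x.
Local Notation C := (convex_minorant T x).

Lemma convex_minorant_convex : convex_function (`[0, T] : set R) C.
Proof. by have [] := convex_minorantP (cadlag_bounded_below T xcadlag). Qed.

Lemma convex_minorant_le u : 0 <= u <= T -> C u <= x u.
Proof.
by have [_ + _] := convex_minorantP (cadlag_bounded_below T xcadlag); exact.
Qed.

Lemma le_convex_minorant g : convex_function (`[0, T] : set R) g ->
  (forall u, 0 <= u <= T -> g u <= x u) -> forall u, 0 <= u <= T -> g u <= C u.
Proof.
by have [_ _ +] := convex_minorantP (cadlag_bounded_below T xcadlag); exact.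
Qed.

(* Otherwise the pointwise maximum of [C] and the chord would be a larger convex
   minorant. *)
Lemma convex_minorant_chord a b q k : 0 <= a -> a < b -> b <= T ->
  C a = q * a + k -> C b = q * b + k ->
  (forall u, a <= u <= b -> q * u + k <= x u) ->
  forall u, a <= u <= b -> C u = q * u + k.
Proof.
move=> a0 ab bT Ca Cb qx u uab.
have cC := convex_minorant_convex.
have ba0 : 0 < b - a by lra.
apply/le_anti/andP; split.
  have := convex_function_chord cC a0 uab bT; rewrite Ca Cb => h.
  by rewrite -(ler_pM2l ba0); lra.
(* The maximum lies below [x]: on [[a, b]] by hypothesis, and elsewhere because convexity puts the
   line below [C]. *)
suff : Num.max (C u) (q * u + k) <= C u by rewrite ge_max => /andP[].
apply: (le_convex_minorant (convex_function_maxr q k cC)); last lra.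
move=> {uab}u /andP[u0 uT]; rewrite ge_max convex_minorant_le ?u0//=.
have [ua|au] := ltP u a.
  apply: le_trans (_ : C u <= _); last by rewrite convex_minorant_le ?u0.
  have := @convex_function_chord _ _ _ cC u a b u0 ltac:(lra) bT.
  by rewrite Ca Cb => h; rewrite -(ler_pM2l ba0); lra.
have [bu|ub] := ltP b u; last by rewrite qx ?au.
apply: le_trans (_ : C u <= _); last by rewrite convex_minorant_le ?u0.
have := @convex_function_chord _ _ _ cC a b u a0 ltac:(lra) uT.
by rewrite Ca Cb => h; rewrite -(ler_pM2l ba0); lra.
Qed.

(** Convexity alone allows a jump at the endpoint [0]. The upper bound comes from [C <= x] and right
    continuity of [x], the lower one from a steep line below [x]. *)
Lemma convex_minorant_near0 e : 0 < T -> 0 < e ->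
  exists2 r, 0 < r & forall u, 0 <= u <= T -> u < r -> `|C u - x 0| < e.
Proof.
move=> T0 e0; have [xr _] := xcadlag.
have [m xm] := cadlag_bounded_below T xcadlag.
have e20 : 0 < e / 2 by lra.
have /cvgrPdist_lt /(_ _ e20) := xr 0 (lexx 0).
move=> /nbhs_right0P [r /= r0 hr].
have {}hr u : 0 <= u < r -> `|x u - x 0| < e / 2.
  move=> /andP[]; rewrite le_eqVlt => /predU1P[<- _|u0 ur].
    by rewrite subrr normr0.
  rewrite distrC; have := hr u; rewrite /= !add0r; apply => //.
  by rewrite normrN gtr0_norm.
(* With this slope the line from [x 0 - e / 2] has dropped below the lower bound [m] of [x] by time
   [r]. *)
pose K := `|x 0 - m| / r.
have K0 : 0 <= K by rewrite divr_ge0 // ltW.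
have line u : 0 <= u <= T -> - K * u + (x 0 - e / 2) <= C u.
  apply: (@le_convex_minorant (fun u => - K * u + (x 0 - e / 2)))
    => [|{}u /andP[u0 uT]].
    apply/convex_functionP => p y z _ _ _.
    by rewrite le_eqVlt; apply/orP; left; apply/eqP; ring.
  have [ur|ru] := ltP u r.
    have := hr u; rewrite u0 ur => /(_ isT) /ltr_normlP[h1 h2].
    have : 0 <= K * u by rewrite mulr_ge0.
    lra.
  have : `|x 0 - m| <= K * u.
    by rewrite /K -mulrA ler_peMr // mulrC ler_pdivlMr ?mul1r.
  have := xm u; rewrite u0 uT => /(_ isT).
  have := ler_norm (x 0 - m); lra.
exists (Num.min r (e / 2 / (K + 1))).
  by rewrite lt_min r0 divr_gt0 //; lra.
move=> u uT; rewrite lt_min => /andP[ur]; have [u0 _] := andP uT.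
rewrite ltr_pdivlMr; last lra.
move=> uK; have := hr u; rewrite u0 ur => /(_ isT).
rewrite !ltr_norml => /andP[h1 h2].
have := convex_minorant_le uT; have := line u uT.
by move=> h3 h4; apply/andP; split; lra.
Qed.

(* If [C] stayed below [x] around [t], it would be affine there. *)
Lemma convex_minorant_touch t k : 0 < t < T ->
  (forall u, 0 < u < t -> right_deriv C u <= k) ->
  (forall u, t < u < T -> k < right_deriv C u) ->
  C t = Num.min (x t) (left_limit x t).
Proof.
move=> /andP[t0 tT] Ck kC; have cC := convex_minorant_convex.
have [xr /(_ _ t0) xl] := xcadlag; have {}xr := xr t (ltW t0).
have tT' : 0 < t < T by rewrite t0.
rewrite /left_limit t0; set l := lim _.
have Cnear e := @convex_function_near _ _ _ cC t e tT'.
apply/le_anti/andP; split.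
  rewrite le_min; apply/andP; split.
    by apply: convex_minorant_le; rewrite !ltW.
  apply/ler_addgt0Pr => e e0; rewrite -lerBlDr; apply: limr_ge => //.
  have [r r0 hr] := Cnear e e0.
  near=> u.
  have u0 : 0 < u by near: u; exact: nbhs_left_gt.
  have ut : u < t by near: u; exact: nbhs_left_lt.
  have utr : t - u < r by near: u; exact: nbhs_left_ltBl.
  have := hr u ltac:(lra); rewrite ltr0_norm ?subr_lt0// opprB => /(_ utr).
  have := @convex_minorant_le u ltac:(lra).
  by rewrite ltr_norml => h1 /andP[h2 h3]; lra.
rewrite leNgt; apply/negP; rewrite lt_min => /andP[Cx Cl].
(* Half the smaller gap leaves both [x t] and the left limit strictly above [C t + e], hence
   [C t + e <= x] around [t]. *)
pose e := Num.min (x t - C t) (l - C t) / 2.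
have [e0 ex el] : [/\ 0 < e, C t + e < x t & C t + e < l].
  have : 0 < e by rewrite divr_gt0// lt_min !subr_gt0 Cx.
  rewrite /e; have : Num.min (x t - C t) (l - C t) <= x t - C t.
    by rewrite ge_min lexx.
  have : Num.min (x t - C t) (l - C t) <= l - C t by rewrite ge_min lexx orbT.
  by move=> *; split; lra.
have : \forall u \near t, C t + e <= x u.
  have /cvgr_ge /(_ _ ex) := xr; rewrite near_withinE => hr.
  have /cvgr_ge /(_ _ el) := xl; rewrite near_withinE => hl.
  near=> u; have [ut|tu|->] := ltgtP u t; last exact: ltW.
  - exact: (near hl u).
  - exact: (near hr u).
move=> [r1 /= r10 hr1]; have [r2 r20 hr2] := Cnear e e0.
pose r := Num.min (Num.min r1 r2) (Num.min t (T - t)) / 2.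
have [r0 rr1 rr2 rt rT] : [/\ 0 < r, r < r1, r < r2, r < t & r < T - t].
  have r2_gt0 : 0 < Num.min (Num.min r1 r2) (Num.min t (T - t)).
    by rewrite !lt_min r10 r20 t0 subr_gt0.
  have h z : Num.min (Num.min r1 r2) (Num.min t (T - t)) <= z -> r < z.
    by move=> ?; rewrite /r; lra.
  split; first by rewrite /r divr_gt0.
  - by apply: h; rewrite !ge_min lexx.
  - by apply: h; rewrite !ge_min lexx orbT.
  - by apply: h; rewrite !ge_min lexx !orbT.
  - by apply: h; rewrite !ge_min lexx !orbT.
clearbody r; pose a := t - r; pose b := t + r.
have [Ca Cb] : C a <= C t + e /\ C b <= C t + e.
  have := hr2 a; have := hr2 b; rewrite /a /b.
  have -> : t + r - t = r by rewrite addrC addKr.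
  have -> : t - r - t = - r by rewrite addrC addKr.
  rewrite normrN gtr0_norm // => /(_ ltac:(lra) rr2) + /(_ ltac:(lra) rr2).
  by rewrite !ltr_norml => /andP[? ?] /andP[? ?]; split; lra.
pose q := (C b - C a) / (b - a).
have ba : b - a = 2 * r by rewrite /a /b; ring.
have chord u : q * u + (C a - q * a) = C a + (C b - C a) / (b - a) * (u - a).
  by rewrite /q; ring.
have ba0 : b - a != 0 by rewrite ba gt_eqF //; lra.
have := @convex_minorant_chord a b q (C a - q * a).
rewrite {1 2}/a {1 2}/b => /(_ ltac:(lra) ltac:(lra) ltac:(lra)).
rewrite !chord subrr mulr0 addr0 divfK // (addrC (C a)) subrK.
move=> /(_ erefl erefl) H.
(* The chord over [[a, b]] stays below [C t + e], hence below [x], so [C] is affine there. Its slope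
   [q] is then at most [k] to the left of [t] and above [k] to the right, a contradiction. *)
have /affine_right_deriv : forall u, a <= u <= b -> C u = q * u + (C a - q * a).
  apply: H => u /andP[au ub]; rewrite chord.
  apply: le_trans (_ : C t + e <= _); last first.
    by apply: hr1 => /=; rewrite ltr_norml; move: au ub; rewrite /a /b => *; lra.
  have ba_gt0 : 0 < b - a by rewrite ba; lra.
  rewrite mulrAC -lerBrDl ler_pdivrMr //.
  apply: le_trans (_ : (C t + e - C a) * (u - a) <= _).
    by rewrite ler_wpM2r ?subr_ge0//; lra.
  by rewrite ler_wpM2l ?subr_ge0//; lra.
move=> /(_ _ cC) /(_ ltac:(rewrite /a; lra) ltac:(rewrite /b; lra)) Cq.
have := Ck (t - r / 2) ltac:(lra); have := kC (t + r / 2) ltac:(lra).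
rewrite !Cq; [lra| |]; rewrite /a /b; lra.
Unshelve. all: by end_near. Qed.

(** The witness [v] makes the set of times nonempty, so the extended infimum is a real one and the
    truncation at [T] has no effect. Monotonicity of the right derivative then separates the slopes
    at [t]. *)
Lemma vertex_timeP c k v : convex_function (`[0, T] : set R) c ->
  0 < v < T -> k < right_deriv c v ->
  let t := vertex_time T c k in
  [/\ 0 <= t <= v, forall u, 0 < u < t -> right_deriv c u <= k &
      forall u, t < u < T -> k < right_deriv c u].
Proof.
move=> cc vT kv t; pose A := [set u | 0 < u < T /\ k < right_deriv c u].
have lbA : lbound A 0 by move=> u [/andP[/ltW]].
have Av : A v by [].
have hA : has_inf A by split; [exists v | exists 0].
have tE : t = inf A.
  rewrite /t /vertex_time -/A ereal_inf_EFin; [|exact: hA.2|exact: hA.1].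
  rewrite min_l // lee_fin; apply: (le_trans (ge_inf hA.2 Av)).
  by move: vT => /andP[_ /ltW].
split.
- by rewrite tE (ge_inf hA.2 Av) lb_le_inf //; exists v.
- move=> u /andP[u0]; rewrite tE => ut; rewrite leNgt; apply/negP => ku.
  suff /(ge_inf hA.2) : A u by rewrite leNgt ut.
  split=> //; rewrite u0 /= (lt_le_trans ut) // (le_trans (ge_inf hA.2 Av)) //.
  by rewrite ltW //; case/andP: vT.
- move=> u /andP[]; rewrite tE => /(inf_lt hA.1)[w [/andP[w0 wT] kw] wu] uT.
  by apply: (lt_le_trans kw); apply: (convex_function_right_deriv_nd cc) => //;
    exact: ltW.
Qed.

End convex_minorant.

(** * Limits inferior and superior as eventual inequalities *)

Section limit_inferior.
Context {R : realType} {U : choiceType} {X : filteredType U}.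
Context (G : set_system X) {FG : Filter G}.
Implicit Types (u : X -> \bar R) (l : \bar R).
Local Open Scope ereal_scope.

Lemma lt_limf_einf u l : l < limf_einf u G -> \forall t \near G, l < u t.
Proof.
rewrite limf_einfE => /ereal_sup_gt[_ [A GA <-] lA].
apply: filterS GA => t At; apply: (lt_le_trans lA).
by apply: ereal_inf_lbound; exists t.
Qed.

Lemma limf_esup_lt u l : limf_esup u G < l -> \forall t \near G, u t < l.
Proof.
rewrite limf_esupE => /ereal_inf_lt[_ [A GA <-] lA].
apply: filterS GA => t At; apply: le_lt_trans lA.
by apply: ereal_sup_ubound; exists t.
Qed.

Lemma limf_einf_ge u l : (\forall t \near G, l <= u t) -> l <= limf_einf u G.
Proof.
move=> lu; rewrite limf_einfE; apply: le_ereal_sup_tmp.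
exists (ereal_inf (u @` [set t | l <= u t])); first by exists [set t | l <= u t].
by apply: le_ereal_inf_tmp => _ [t /= + <-].
Qed.

Lemma limf_einf_le u (M : R) :
  (forall K : R, (M < K)%R -> ~ \forall t \near G, K%:E <= u t) ->
  limf_einf u G <= M%:E.
Proof.
move=> notK; rewrite leNgt; apply/negP => Mu.
(* The midpoint serves for a finite limit inferior; the value [+oo] takes [M + 1] instead. *)
have [K MK Ku] : exists2 K : R, (M < K)%R & K%:E < limf_einf u G.
  move: (limf_einf u G) Mu => [r|_|//].
    by rewrite lte_fin => Mr; exists ((M + r) / 2)%R; rewrite ?lte_fin; lra.
  by exists (M + 1)%R; [lra | rewrite ltry].
by apply: (notK K MK); apply: filterS (lt_limf_einf Ku) => t /ltW.
Qed.

End limit_inferior.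

(** * Monotonicity from increments, and increments of a primitive *)

Section increments.
Context {R : realType}.
Implicit Types (E f : R -> R).

(* Bisecting [a, b] repeatedly divides the error term by [2 ^ n]. *)
Lemma nondecreasing_of_increments E f a b : a <= b ->
  (forall u v, a <= u -> u <= v -> v <= b ->
    - ((v - u) * (f v - f u)) <= E v - E u) ->
  E a <= E b.
Proof.
move=> ab incr.
(* On the two halves the lengths are halved while the increments of [f] telescope, so the total
   error is halved. *)
have bisect n : forall u v, a <= u -> u <= v -> v <= b ->
    - ((v - u) * (f v - f u)) / 2 ^+ n <= E v - E u.
  elim: n => [|n IH] u v au uv vb; first by rewrite expr0 divr1 incr.
  have := IH u ((u + v) / 2) au ltac:(lra) ltac:(lra).
  have := IH ((u + v) / 2) v ltac:(lra) ltac:(lra) vb.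
  by rewrite exprS invfM; lra.
pose D := (b - a) * (f b - f a).
rewrite leNgt; apply/negP => ba.
have [n hn] : exists n, `|D| < (E a - E b) * 2 ^+ n.
  exists (Num.bound (`|D| / (E a - E b))).
  rewrite mulrC -ltr_pdivrMr ?subr_gt0 //.
  apply: lt_trans (archi_boundP _) _; first by rewrite divr_ge0 // subr_ge0 ltW.
  by rewrite -natrX ltr_nat ltn_expl.
have := bisect n a b (lexx a) ab (lexx b); rewrite -/D.
rewrite ler_pdivrMr ?exprn_gt0 //; have := ler_norm D; lra.
Qed.

(** The comparison with [C] sees the integral only through these bounds, its value at [0] and its
    positivity. *)
Lemma Rintegral_increments f :
  {within `[0, +oo[, continuous f} ->
  (forall t u, 0 <= t -> t <= u -> f t <= f u) ->
  forall a b, 0 <= a -> a <= b ->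
    (b - a) * f a <= \int[lebesgue_measure]_(u in `[0, b]) f u -
      \int[lebesgue_measure]_(u in `[0, a]) f u <= (b - a) * f b.
Proof.
move=> fc fnd a b a0 ab.
have intf : lebesgue_measure.-integrable `[0, b] (EFin \o f).
  apply: continuous_compact_integrable; first exact: segment_compact.
  by apply: continuous_subspaceW fc; apply: subset_itvl.
rewrite Rintegral_itvB //.
have intab : lebesgue_measure.-integrable `]a, b] (EFin \o f).
  by apply: integrableS intf => //; apply: subset_itvr; rewrite bnd_simp.
have intc (k : R) : lebesgue_measure.-integrable `]a, b] (EFin \o cst k).
  have : lebesgue_measure.-integrable `[a, b] (EFin \o cst k).
    apply: continuous_compact_integrable; first exact: segment_compact.
    by apply: continuous_subspaceT => u; exact: cvg_cst.
  by move=> /integrableS; apply => //; apply: subset_itvr; rewrite bnd_simp.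
have cstE (k : R) : \int[lebesgue_measure]_(u in `]a, b]) (cst k u) = (b - a) * k.
  rewrite Rintegral_cst //= lebesgue_measure_itv /= lte_fin mulrC.
  move: ab; rewrite le_eqVlt => /predU1P[->|ab]; first by rewrite ltxx subrr.
  by rewrite ab.
apply/andP; split.
  rewrite -cstE; apply: le_Rintegral => // u; rewrite /= in_itv /= => /andP[au ub].
  by apply: fnd => //; exact: ltW.
rewrite -cstE; apply: le_Rintegral => // u; rewrite /= in_itv /= => /andP[au ub].
by apply: fnd => //; apply: le_trans (ltW au).
Qed.

End increments.

(** * Behaviour of [C] and [x] to the right of [tau] *)

Lemma slopes_right_limit {R : realType} (T s : R) c :
  right_limit_points (slopes T c) s ->
  forall e, 0 < e -> exists2 t, 0 < t < T & s < right_deriv c t < s + e.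
Proof.
move=> lim e /lim[r [[a [b [[a0 _ bT _] [t /andP[atl tb] <-]]]] /= re]].
exists t => //; apply/andP.
by split; [exact: le_lt_trans atl | exact: lt_le_trans bT].
Qed.

Section vertex.
Context {R : realType} (T s : R) (x : R -> R).
Hypothesis xcadlag : cadlag x.
Local Notation C := (convex_minorant T x).
Hypothesis limS : right_limit_points (slopes T C) s.
Local Notation tau := (vertex_time T C s).
Local Notation m := (Num.min (x tau) (left_limit x tau)).

Let cC : convex_function (`[0, T] : set R) C.
Proof. exact: convex_minorant_convex. Qed.

Lemma vertex_time_right_limit : [/\ 0 <= tau, tau < T,
  forall u, 0 < u < tau -> right_deriv C u <= s &
  forall u, tau < u < T -> s < right_deriv C u].
Proof.
have [v vT /andP[sv _]] := slopes_right_limit limS ltr01.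
have [/andP[t0 tv] ? ?] := vertex_timeP cC vT sv.
by split=> //; apply: le_lt_trans tv _; case/andP: vT.
Qed.

(** Right continuity of [C] at [tau] with value [m]. If [tau = 0], then [m = x 0] and the endpoint
    lemma applies; otherwise [C] touches at the vertex [tau] and is continuous there. *)
Lemma convex_minorant_vertex_time e : 0 < e ->
  exists2 r, 0 < r & forall u, 0 <= u < r ->
    tau + u < T /\ `|C (tau + u) - m| < e.
Proof.
have [t0 tT Cs sC] := vertex_time_right_limit.
move=> e0; suff [r r0 hr] : exists2 r, 0 < r & forall u, 0 <= u <= T ->
    tau <= u -> u - tau < r -> `|C u - m| < e.
  exists (Num.min r (T - tau)); first by rewrite lt_min r0 subr_gt0.
  move=> u /andP[u0]; rewrite lt_min => /andP[ur uT].
  split; first lra.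
  by apply: hr; [lra | lra | rewrite addrC addKr].
move: t0; rewrite le_eqVlt => /predU1P[t0|t0].
  rewrite /left_limit -t0 ltxx minxx.
  have [r r0 hr] := convex_minorant_near0 xcadlag (ltac:(lra) : 0 < T) e0.
  by exists r => // u uT _; rewrite subr0; exact: hr.
rewrite -(convex_minorant_touch xcadlag (ltac:(lra) : 0 < tau < T) Cs sC).
have [r r0 hr] := convex_function_near cC (ltac:(lra) : 0 < tau < T) e0.
by exists r => // u uT tu ur; apply: hr => //; rewrite ger0_norm ?subr_ge0.
Qed.

Section comparison.
Variables (f F : R -> R) (M : R).
Hypotheses (M0 : 0 < M) (f0 : forall t, 0 <= t -> 0 <= f t).
Hypothesis fnd : forall t u, 0 <= t -> t <= u -> f t <= f u.
Hypothesis F0 : F 0 = 0.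
Hypothesis Fincr : forall a b, 0 <= a -> a <= b ->
  (b - a) * f a <= F b - F a <= (b - a) * f b.

(** The subgradient at the left end [u] gains [M * f u] per unit of time while [F] costs at most
    [M * f v]; the deficit is the error allowed by [nondecreasing_of_increments]. *)
Lemma right_deriv_minorant_lower :
  (\forall t \near 0^'+, M * f t <= right_deriv C (t + tau) - s) ->
  \forall t \near 0^'+, M * F t <= C (t + tau) - m - s * t.
Proof.
have [t0 tT _ _] := vertex_time_right_limit.
move=> [r /= r0 hr].
have {}hr u : 0 < u < r -> s + M * f u <= right_deriv C (tau + u).
  move=> /andP[u0 ur]; have := hr u; rewrite /= sub0r normrN gtr0_norm // (addrC u).
  by move=> /(_ ur u0); lra.
have [r' r'0 hr'] := convex_minorant_vertex_time ltr01.
near=> t.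
have t_gt0 : 0 < t by near: t; exact: nbhs_right_gt.
have tr : t < r by near: t; exact: nbhs_right_lt.
have tr' : t < r' by near: t; exact: nbhs_right_lt.
have [tT' _] : tau + t < T /\ `|C (tau + t) - m| < 1 by apply: hr'; rewrite ltW.
pose D u := C (tau + u) - s * u - M * F u.
(* Only positive [a] are treated: [tau] may be [0], where no subgradient is available. The value [m]
   is then reached by letting [a] tend to [0]. *)
have Dnd a : 0 < a -> a <= t -> D a <= D t.
  move=> a0 at'; apply: (@nondecreasing_of_increments _ D (fun u => M * f u)) => //.
  move=> u v au uv vt.
  have := @convex_function_subgradient _ T C cC (tau + u) (tau + v)
    ltac:(lra) ltac:(lra).
  have : (v - u) * (s + M * f u) <= (v - u) * right_deriv C (tau + u).
    by rewrite ler_wpM2l ?subr_ge0 // hr //; apply/andP; split; lra.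
  have /andP[_] := Fincr (ltac:(lra) : 0 <= u) uv.
  rewrite -(ler_pM2l M0) /D (_ : tau + v - (tau + u) = v - u); last by ring.
  lra.
suff : m <= D t by rewrite /D (addrC t); lra.
apply/ler_addgt0Pr => e e0; have e20 : 0 < e / 2 by lra.
have [r2 r20 hr2] := convex_minorant_vertex_time e20.
(* Since [F a <= a * f t], the terms [s * a] and [M * F a] together cost at most [K * a < e / 2];
   the other half of [e] pays for replacing [C (tau + a)] by [m]. *)
pose K := `|s| + M * f t + 1.
have Mft : 0 <= M * f t by rewrite mulr_ge0 ?f0 // ltW.
have K0 : 0 < K by rewrite /K; have := normr_ge0 s; lra.
near (0 : R)^'+ => a.
have a0 : 0 < a by near: a; exact: nbhs_right_gt.
have at' : a < t by near: a; exact: nbhs_right_lt.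
have ar2 : a < r2 by near: a; exact: nbhs_right_lt.
have : a < e / 2 / K by near: a; apply: nbhs_right_lt; rewrite divr_gt0.
rewrite ltr_pdivlMr // => aK.
apply: le_trans (_ : D a + e <= _); last by rewrite lerD2r Dnd // ltW.
have [_] : tau + a < T /\ `|C (tau + a) - m| < e / 2 by apply: hr2; rewrite ltW.
rewrite ltr_norml => /andP[Ca _].
have : s * a <= `|s| * a by rewrite ler_pM2r // ler_norm.
have /andP[_] := Fincr (lexx 0) (ltW a0); rewrite F0 !subr0 -(ler_pM2l M0).
have : a * (M * f a) <= a * (M * f t).
  by rewrite ler_pM2l // ler_pM2l // fnd // ltW.
rewrite /D; move: aK; rewrite /K; lra.
Unshelve. all: by end_near. Qed.

(** Mirror image of the lower bound: [D] changes sign and the subgradient is taken at the right end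
    [v]. *)
Lemma right_deriv_minorant_upper :
  (\forall t \near 0^'+, right_deriv C (t + tau) - s <= M * f t) ->
  \forall t \near 0^'+, C (t + tau) - m - s * t <= M * F t.
Proof.
have [t0 tT _ _] := vertex_time_right_limit.
move=> [r /= r0 hr].
have {}hr u : 0 < u < r -> right_deriv C (tau + u) <= s + M * f u.
  move=> /andP[u0 ur]; have := hr u; rewrite /= sub0r normrN gtr0_norm // (addrC u).
  by move=> /(_ ur u0); lra.
have [r' r'0 hr'] := convex_minorant_vertex_time ltr01.
near=> t.
have t_gt0 : 0 < t by near: t; exact: nbhs_right_gt.
have tr : t < r by near: t; exact: nbhs_right_lt.
have tr' : t < r' by near: t; exact: nbhs_right_lt.
have [tT' _] : tau + t < T /\ `|C (tau + t) - m| < 1 by apply: hr'; rewrite ltW.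
pose D u := s * u + M * F u - C (tau + u).
have Dnd a : 0 < a -> a <= t -> D a <= D t.
  move=> a0 at'; apply: (@nondecreasing_of_increments _ D (fun u => M * f u)) => //.
  move=> u v au uv vt.
  have := @convex_function_subgradient _ T C cC (tau + v) (tau + u)
    ltac:(lra) ltac:(lra).
  have : (v - u) * right_deriv C (tau + v) <= (v - u) * (s + M * f v).
    by rewrite ler_wpM2l ?subr_ge0 // hr //; apply/andP; split; lra.
  have /andP[+ _] := Fincr (ltac:(lra) : 0 <= u) uv.
  rewrite -(ler_pM2l M0) /D (_ : tau + u - (tau + v) = - (v - u)); last by ring.
  lra.
suff : - m <= D t by rewrite /D (addrC t); lra.
apply/ler_addgt0Pr => e e0; have e20 : 0 < e / 2 by lra.
have [r2 r20 hr2] := convex_minorant_vertex_time e20.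
pose K := `|s| + 1.
have K0 : 0 < K by rewrite /K; have := normr_ge0 s; lra.
near (0 : R)^'+ => a.
have a0 : 0 < a by near: a; exact: nbhs_right_gt.
have at' : a < t by near: a; exact: nbhs_right_lt.
have ar2 : a < r2 by near: a; exact: nbhs_right_lt.
have : a < e / 2 / K by near: a; apply: nbhs_right_lt; rewrite divr_gt0.
rewrite ltr_pdivlMr // => aK.
apply: le_trans (_ : D a + e <= _); last by rewrite lerD2r Dnd // ltW.
have [_] : tau + a < T /\ `|C (tau + a) - m| < e / 2 by apply: hr2; rewrite ltW.
rewrite ltr_norml => /andP[_ Ca].
have : - `|s| * a <= s * a by rewrite ler_pM2r // lerNl -normrN ler_norm.
have /andP[+ _] := Fincr (lexx 0) (ltW a0); rewrite F0 !subr0 -(ler_pM2l M0).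
have : 0 <= M * (a * f 0) by rewrite !mulr_ge0 ?f0 // ltW.
rewrite /D; move: aK; rewrite /K; lra.
Unshelve. all: by end_near. Qed.

Hypothesis F_gt0 : forall t, 0 < t -> 0 < F t.

(* Vertices of [C] accumulate at [tau] from the right, and at each of them [C]
   agrees with [x] or with its left limit. *)
Lemma right_deriv_path_upper K : M < K ->
  (\forall t \near 0^'+, right_deriv C (t + tau) - s <= M * f t) ->
  ~ (\forall t \near 0^'+, K * F t <= x (t + tau) - m - s * t).
Proof.
move=> MK /right_deriv_minorant_upper hC hx.
have [t0 tT Cs sC] := vertex_time_right_limit.
have Fnd a b : 0 <= a -> a <= b -> F a <= F b.
  move=> a0 ab; have /andP[h _] := Fincr a0 ab.
  by rewrite -subr_ge0; apply: le_trans h; rewrite mulr_ge0 ?subr_ge0 ?f0.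
have [r [r0 rT gap]] : exists r, [/\ 0 < r, tau + r < T &
    forall u, tau < u <= tau + r -> (K - M) * F (u - tau) <= x u - C u].
  have [r /= r0 hr] : \forall t \near 0^'+,
      (K - M) * F t <= x (t + tau) - C (t + tau).
    apply: filterS2 hC hx => t; rewrite mulrBl; lra.
  pose r' := Num.min r (T - tau) / 2.
  have [r'0 rr' rT'] : [/\ 0 < r', r' < r & r' < T - tau].
    have h0 : 0 < Num.min r (T - tau) by rewrite lt_min r0 subr_gt0.
    have h1 : Num.min r (T - tau) <= r by rewrite ge_min lexx.
    have h2 : Num.min r (T - tau) <= T - tau by rewrite ge_min lexx orbT.
    by rewrite /r'; split; lra.
  exists r'; split=> //; [lra | move=> u /andP[tu ur]].
  have := hr (u - tau); rewrite /= sub0r normrN subrK gtr0_norm ?subr_gt0 //.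
  by apply; lra.
have utau : tau < tau + r < T by rewrite ltrDl r0.
have sr := sC _ utau.
have [v vT /andP[sv vr]] :=
  slopes_right_limit limS (ltac:(lra) : 0 < right_deriv C (tau + r) - s).
(* Slopes before [tau] are at most [s]. If [v = tau], a further time [w] with slope strictly between
   [s] and that at [v] would contradict monotonicity. *)
have tauv : tau < v.
  rewrite ltNge; apply/negP; rewrite le_eqVlt => /predU1P[vE|vtau]; last first.
    by have := Cs v; have /andP[-> _] := vT; rewrite vtau leNgt sv => /(_ isT).
  have [w wT /andP[sw wv]] :=
    slopes_right_limit limS (ltac:(lra) : 0 < right_deriv C v - s).
  have [wtau|tauw] := ltP w tau.
    by have := Cs w; have /andP[-> _] := wT; rewrite wtau leNgt sw => /(_ isT).
  have /andP[v0 _] := vT; have /andP[_ wT'] := wT.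
  have := convex_function_right_deriv_nd cC v0 (ltac:(lra) : v <= w) wT'.
  lra.
(* The vertex time [z] of slope [k] satisfies [tau < v <= z <= tau + r], so it is a point of contact
   inside the range of [gap]. *)
pose k := right_deriv C v.
have kr : k < right_deriv C (tau + r) by rewrite /k; lra.
have [] := vertex_timeP cC (ltac:(lra) : 0 < tau + r < T) kr.
set z := vertex_time _ _ _ => /andP[z0 zr] Ck kC.
have vz : v <= z.
  rewrite leNgt; apply/negP => zv; have := kC v; rewrite ltxx zv.
  by case/andP: vT => _ -> /(_ isT).
have zT : 0 < z < T by apply/andP; split; lra.
have touch := convex_minorant_touch xcadlag zT Ck kC.
(* Evaluating [F] at half the distance gives one margin valid on all of [[(tau + z) / 2, z]], so it
   survives in the left limit at [z]. *)
pose e := (K - M) * F ((z - tau) / 2).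
have e0 : 0 < e by rewrite mulr_gt0 ?subr_gt0 // F_gt0 //; lra.
have gap' u : (tau + z) / 2 <= u <= z -> C u + e <= x u.
  move=> /andP[ul uz]; have := gap u ltac:(lra).
  have : e <= (K - M) * F (u - tau).
    by rewrite /e ler_pM2l ?subr_gt0 // Fnd //; lra.
  lra.
have : C z + e / 2 <= C z.
  rewrite [leRHS]touch le_min; apply/andP; split.
    by have := gap' z ltac:(lra); lra.
  rewrite /left_limit (ltac:(lra) : 0 < z).
  apply: limr_ge; first by apply: xcadlag.2; lra.
  have [r1 r10 hr1] := convex_function_near cC zT (ltac:(lra) : 0 < e / 2).
  near=> u.
  have u1 : (tau + z) / 2 <= u by near: u; apply: nbhs_left_ge; lra.
  have u2 : u < z by near: u; exact: nbhs_left_lt.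
  have u3 : z - u < r1 by near: u; exact: nbhs_left_ltBl.
  have := hr1 u ltac:(lra); rewrite ltr0_norm ?subr_lt0 // opprB => /(_ u3).
  by rewrite ltr_norml => /andP[h1 h2]; have := gap' u ltac:(lra); lra.
lra.
Unshelve. all: by end_near. Qed.

End comparison.
End vertex.

(** * From paths to almost sure statements *)

Theorem lemma2p15 (d : measure_display) (Omega : measurableType d)
  (R : realType) (P : probability Omega R) (X : R -> Omega -> R)
  (T s : R) (f : R -> R) :
  let C w := convex_minorant T (X ^~ w) in
  let C' w := right_deriv (C w) in
  let tau w := vertex_time T (C w) s in
  let m w := Num.min (X (tau w) w) (left_limit (X ^~ w) (tau w)) in
  let ftilde t := \int[lebesgue_measure]_(u in `[0, t]) f u in
  levy_process P X ->
  ~ compound_poisson_with_drift P X ->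
  0 < T ->
  {ae P, forall w, right_limit_points (slopes T (C w)) s} ->
  (forall t, 0 <= t -> 0 <= f t) ->
  {within `[0, +oo[, continuous f} ->
  (forall t u, 0 <= t -> t < u -> f t < f u) ->
  forall M : R, 0 < M ->
  ({ae P, forall w,
      (M%:E < limf_einf (fun t => ((C' w (t + tau w)%R - s) / f t)%:E) 0^'+)%E} ->
   {ae P, forall w,
      (M%:E <= limf_einf
        (fun t => ((X (t + tau w)%R w - m w - s * t) / ftilde t)%:E) 0^'+)%E})
  /\
  ({ae P, forall w,
      (limf_esup (fun t => ((C' w (t + tau w)%R - s) / f t)%:E) 0^'+ < M%:E)%E} ->
   {ae P, forall w,
      (limf_einf
        (fun t => ((X (t + tau w)%R w - m w - s * t) / ftilde t)%:E) 0^'+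
       <= M%:E)%E}).
Proof.
move=> C C' tau m ftilde hX _ T0 limS f_ge0 fc finc M M0.
have fnd t u : 0 <= t -> t <= u -> f t <= f u.
  by move=> t0; rewrite le_eqVlt => /predU1P[-> //|tu]; rewrite ltW // finc.
have f_gt0 t : 0 < t -> 0 < f t.
  by move=> t0; apply: le_lt_trans (finc _ _ (lexx 0) t0); exact: f_ge0.
have Fincr : forall a b, 0 <= a -> a <= b ->
    (b - a) * f a <= ftilde b - ftilde a <= (b - a) * f b.
  exact: Rintegral_increments.
have F0 : ftilde 0 = 0 by rewrite /ftilde set_itv1 Rintegral_set1.
(* Splitting at [t / 2] gives [ftilde t >= t / 2 * f (t / 2)], which is positive because [f] is
   strictly increasing from a nonnegative value. *)
have F_gt0 t : 0 < t -> 0 < ftilde t.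
  move=> t0; have t20 : 0 < t / 2 by lra.
  have /andP[+ _] := Fincr _ t (ltW t20) (ltac:(lra) : t / 2 <= t).
  have /andP[+ _] := Fincr _ (t / 2) (lexx 0) (ltW t20).
  have := f_ge0 0 (lexx 0); have := f_gt0 _ t20.
  move: (f 0) (f (t / 2)) => y0 y1 y1_gt0 y0_ge0.
  have : 0 < t / 2 * y1 by rewrite mulr_gt0.
  have : 0 <= t / 2 * y0 by rewrite mulr_ge0 // ltW.
  by rewrite F0; lra.
have near_pos (Q : R -> Prop) : (forall t, 0 < t -> Q t) ->
    \forall t \near 0^'+, Q t.
  by move=> hQ; apply: filterS (nbhs_right_gt 0).
split => [hliminf|hlimsup].
  apply: filterS3 (levy_cadlag hX) limS hliminf => w cad lim /lt_limf_einf hw.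
  apply: limf_einf_ge.
  have hC : \forall t \near 0^'+, M * f t <= C' w (t + tau w) - s.
    apply: filterS2 hw (near_pos _ (fun _ => id)) => t; rewrite lte_fin => h t0.
    by rewrite -ler_pdivlMr ?f_gt0 // ltW.
  have := right_deriv_minorant_lower cad lim M0 f_ge0 fnd F0 Fincr hC.
  have [tau0 tauT] : 0 <= tau w /\ tau w < T.
    by have [] := vertex_time_right_limit cad lim.
  (* The inequality [C <= X] is available only up to time [T]. *)
  have near_T : \forall t \near 0^'+, t < T - tau w.
    by apply: nbhs_right_lt; rewrite subr_gt0.
  apply: filterS3 near_T (near_pos _ (fun _ => id)) => t tT t0 h.
  rewrite lee_fin ler_pdivlMr ?F_gt0 //; apply: le_trans h _.
  suff h : C w (t + tau w) <= X (t + tau w) w by rewrite !lerB.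
  by apply: convex_minorant_le => //; move: (tau w) tau0 tauT tT => *; lra.
apply: filterS3 (levy_cadlag hX) limS hlimsup => w cad lim /limf_esup_lt hw.
apply: limf_einf_le => K MK hK.
suff [hC hx] : (\forall t \near 0^'+, C' w (t + tau w) - s <= M * f t) /\
    (\forall t \near 0^'+, K * ftilde t <= X (t + tau w) w - m w - s * t).
  exact: (right_deriv_path_upper cad lim M0 f_ge0 F0 Fincr F_gt0 MK hC hx).
split.
  apply: filterS2 hw (near_pos _ (fun _ => id)) => t; rewrite lte_fin => h t0.
  by rewrite -ler_pdivrMr ?f_gt0 // ltW.
apply: filterS2 hK (near_pos _ (fun _ => id)) => t; rewrite lee_fin => h t0.
by rewrite -ler_pdivlMr ?F_gt0.
Qed.
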